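(* There is a subset $E\subseteq\mathbb{R}^2$ such that $$\dim_{qA}\pi_x(E)=1>\tfrac12=\dim_{qA}E.$$
   Context: $\pi_x$ denotes the orthogonal projection of $\mathbb{R}^2$ onto the $x$-axis. $B(x,R)$ denotes the ball with centre $x$ and radius $R$, and $N_r(A)$ is the least number of balls of radius $r$ needed to cover a bounded set $A$. For $0\le\delta<1$ let $\overline{h_E}(\delta)=\inf\{\alpha\ge0:\exists b,c>0$ such that $\max_{x\in E}N_r(E\cap B(x,R))\le c(R/r)^\alpha$ for all $0<r\le R^{1+\delta}\le R\le b\}$. The quasi-Assouad dimension is $\dim_{qA}E=\lim_{\delta\to0}\overline{h_E}(\delta)$ (limit as $\delta\to0^+$ of a monotone function). *)

(* Defs.v *)
From HB Require Import structures.
From mathcomp Require Import all_boot all_order all_algebra.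
From mathcomp Require Import all_classical all_reals all_analysis.

Set Implicit Arguments.
Unset Strict Implicit.
Unset Printing Implicit Defensive.

Import Order.TTheory GRing.Theory Num.Theory.
Import numFieldNormedType.Exports.

Local Open Scope classical_set_scope.
Local Open Scope ring_scope.

(* The library's norm on R * R is the sup norm, hence an explicit
   Euclidean distance. *)
Definition eucl_dist (R : realType) (p q : R * R) : R :=
  Num.sqrt ((p.1 - q.1) ^+ 2 + (p.2 - q.2) ^+ 2).

Definition eucl_ball (R : realType) (x : R * R) (r : R) : set (R * R) :=
  [set y | eucl_dist x y < r].

(* The values being infimized are natural numbers, so the infimum is a least
   element; it is +oo when no finite cover exists. The centres of the balls
   need not belong to A. *)
Definition covering_number (R : realType) (r : R) (A : set (R * R)) : \bar R :=
  ereal_inf [set (size s)%:R%:E | s in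
    [set s : seq (R * R) | A `<=` \bigcup_(z in [set` s]) eucl_ball z r]].

(* The condition on r and rho forces 0 < rho: for rho <= 0, the value
   rho `^ (1 + delta) is 0 if rho = 0 and 1 if rho < 0. *)
Definition hbar (R : realType) (E : set (R * R)) (delta : R) : \bar R :=
  ereal_inf [set alpha%:E | alpha in [set alpha : R | 0 <= alpha /\
    exists b c : R, [/\ 0 < b, 0 < c &
      forall r rho : R,
        0 < r -> r <= rho `^ (1 + delta) -> rho `^ (1 + delta) <= rho ->
        rho <= b ->
        (ereal_sup [set covering_number r (E `&` eucl_ball x rho) | x in E]
           <= (c * (rho / r) `^ alpha)%:E)%E]]].

(* hbar E is nonincreasing on [0, 1[, so this limit always exists. *)
Definition dim_qA (R : realType) (E : set (R * R)) : \bar R :=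
  lim (hbar E delta @[delta --> 0^'+]).

Definition proj_x (R : realType) (p : R * R) : R * R := (p.1, 0).

(* Main.v *)
(* The quasi-Assouad dimension only sees small balls, whereas the projection
   superposes points of E that are far apart vertically. Put a translate by q of
   a Cantor set C of dimension 1/2 at an integer height depending injectively on
   the rational q: balls of radius at most 1/4 meet a single copy of C, while the
   projection contains every rational. At scale 4^-n * 4^-l inside a ball of
   radius 4^-n, both sets need D^l balls up to a constant factor, with D = 2 for
   E and D = 4 for its projection, and 4^s = D gives the dimension s. *)
Require Import Defs.
From mathcomp Require Import all_boot all_order all_algebra.
From mathcomp Require Import all_classical all_reals all_analysis.
From mathcomp Require Import ring lra zify.

Import Order.TTheory GRing.Theory Num.Theory.

Local Open Scope classical_set_scope.
Local Open Scope ring_scope.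

(** * Euclidean balls and separated points *)

Lemma eucl_dist_horizontal (R : realType) (a b y : R) :
  eucl_dist (a, y) (b, y) = `|a - b|.
Proof. by rewrite /eucl_dist /= subrr expr0n addr0 sqrtr_sqr. Qed.

Lemma norm_fst_eucl_dist (R : realType) (p q : R * R) :
  `|p.1 - q.1| <= eucl_dist p q.
Proof. by rewrite -sqrtr_sqr ler_wsqrtr// lerDl sqr_ge0. Qed.

Lemma norm_snd_eucl_dist (R : realType) (p q : R * R) :
  `|p.2 - q.2| <= eucl_dist p q.
Proof. by rewrite -sqrtr_sqr ler_wsqrtr// lerDr sqr_ge0. Qed.

Lemma covering_number_le (R : realType) (r : R) (A : set (R * R))
    (s : seq (R * R)) :
  A `<=` \bigcup_(z in [set` s]) eucl_ball z r ->
  (covering_number r A <= (size s)%:R%:E)%E.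
Proof. by move=> As; apply: ereal_inf_lbound; exists s. Qed.

(** A ball of radius [r] has horizontal width [2 * r <= h], and balls are open, so no ball contains
    two points of [t]. Choosing a ball for each point is therefore injective. *)
Lemma covering_number_separated (R : realType) (r h y : R) (A : set (R * R))
    (t : seq R) :
  2 * r <= h -> uniq t -> (forall u, u \in t -> A (u, y)) ->
  {in t &, forall u v, u != v -> h <= `|u - v|} ->
  ((size t)%:R%:E <= covering_number r A)%E.
Proof.
move=> rh tU tA tsep; apply: le_ereal_inf_tmp => _ [s As <-].
rewrite lee_fin ler_nat.
have /choice[f fP] : forall u, exists z, u \in t ->
    z \in s /\ eucl_ball z r (u, y).
  move=> u; case: (boolP (u \in t)) => [ut|_]; last by exists (0, 0).
  by have [z zs zr] := As _ (tA _ ut); exists z.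
rewrite -(size_map f); apply: uniq_leq_size; last first.
  by move=> _ /mapP[u ut ->]; have [] := fP u ut.
rewrite map_inj_in_uniq// => u v ut vt fuv; apply/eqP; case: eqP => // /eqP uv; exfalso.
have := tsep _ _ ut vt uv.
have [_ /(le_lt_trans (norm_fst_eucl_dist _ _ _))/= fu] := fP u ut.
have [_ /(le_lt_trans (norm_fst_eucl_dist _ _ _))/= fv] := fP v vt.
rewrite fuv in fu; have := ler_distD (f v).1 u v; rewrite (distrC u (f v).1).
by lra.
Qed.

(** * Rounding radii to powers of 1/4 *)

Lemma exists_quarter_expn_lt (R : realType) (x : R) :
  0 < x -> exists n, 4 ^- n < x.
Proof.
move=> x0; exists (Num.bound x^-1).
rewrite invf_plt ?posrE ?exprn_gt0//.
apply: (lt_le_trans (upper_nthrootP (leqnn _))).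
by rewrite lerXn2r ?nnegrE// ler_nat.
Qed.

Lemma exists_quarter_scale (R : realType) (rho : R) :
  0 < rho -> rho <= 4^-1 ->
  exists2 n, (0 < n)%N & 4 ^- n.+1 < rho <= 4 ^- n.
Proof.
move=> rho0 rho4; have exn : exists n, 4 ^- n.+1 < rho.
  have [n nrho] := exists_quarter_expn_lt _ _ rho0; exists n.
  apply: le_lt_trans nrho; rewrite lef_pV2 ?posrE ?exprn_gt0//.
  by rewrite ler_eXn2l ?ltr1n.
case: (ex_minnP exn) => -[|n] nrho nmin.
  by move: nrho; rewrite expr1 ltNge rho4.
exists n.+1; rewrite // nrho leNgt; apply/negP => /nmin.
by rewrite ltnn.
Qed.

(** Take the least [l] with [4 ^- (n + l) <= r]. Minimality costs a factor 4, and comparing [rho]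
    with [4 ^- n.+1] costs another, whence 16. *)
Lemma exists_quarter_scale_between (R : realType) (n : nat) (r rho : R) :
  0 < r -> r <= rho -> 4 ^- n.+1 < rho ->
  exists2 l, 4 ^- (n + l) <= r & 4 ^+ l <= 16 * (rho / r).
Proof.
move=> r0 rrho nrho.
have P4 k : 0 < 4 ^+ k :> R by rewrite exprn_gt0.
have exl : exists l, 4 ^- (n + l) <= r.
  have [l lr] := exists_quarter_expn_lt _ _ r0; exists l.
  apply: le_trans (ltW lr); rewrite lef_pV2 ?posrE//.
  by rewrite ler_eXn2l ?ltr1n// leq_addl.
case: (ex_minnP exl) => -[|l] lr lmin.
  exists 0%N => //; rewrite expr0.
  have : 1 <= rho / r by rewrite ler_pdivlMr// mul1r.
  by lra.
exists l.+1 => //; have : r < 4 ^- (n + l).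
  by rewrite ltNge; apply/negP => /lmin; rewrite ltnn.
rewrite mulrA ler_pdivlMr// exprD invfM => rn.
have nrho' : 4 ^- n < 4 * rho.
  by move: nrho; rewrite exprS invfM; lra.
have := P4 l; set x := 4 ^+ l in rn * => x0.
have : x * r < 4 ^- n.
  by rewrite mulrC -ltr_pdivlMr.
by rewrite exprS -/x; lra.
Qed.

(** * A criterion for the quasi-Assouad dimension *)

Lemma powR_expn_swap (R : realType) (s : R) (l : nat) :
  ((4 : R) ^+ l) `^ s = (4 `^ s) ^+ l.
Proof.
by rewrite -!powR_mulrn ?powR_ge0// -!powRrM mulrC.
Qed.

Lemma ge_powR_exponent (R : realType) (alpha s c : R) (l0 : nat) :
  0 < c ->
  (forall l, (l0 <= l)%N -> ((4 : R) ^+ l) `^ s <= c * (2 * 4 ^+ l) `^ alpha) ->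
  s <= alpha.
Proof.
move=> c0 H; rewrite leNgt; apply/negP => as_.
have e0 : 0 < s - alpha by rewrite subr_gt0.
set M := c * 2 `^ alpha.
have M0 : 0 < M by rewrite mulr_gt0// powR_gt0.
set X := M `^ (s - alpha)^-1.
pose l := maxn l0 (Num.bound X).
have lX : X < 4 ^+ l.
  apply: (lt_le_trans (upper_nthrootP (leq_maxr l0 _))).
  by rewrite lerXn2r ?nnegrE// ler_nat.
have := H l (leq_maxl _ _); rewrite powRM ?exprn_ge0// mulrA -/M.
rewrite -{1}(subrK alpha s) powRD; last by rewrite expf_eq0 pnatr_eq0 andbF implybT.
rewrite ler_pM2r ?powR_gt0 ?exprn_gt0// leNgt => /negP; apply.
have -> : M = X `^ (s - alpha).
  by rewrite -powRrM mulVf ?gt_eqF// powRr1// ltW.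
by apply: gt0_ltr_powR; rewrite ?nnegrE ?powR_ge0 ?exprn_ge0.
Qed.

Lemma hbar_homogeneous (R : realType) (E : set (R * R)) (D K : nat) (s delta : R) :
  0 <= s -> 4 `^ s = D%:R -> 0 < delta ->
  (forall x n l, E x -> (0 < n)%N -> exists2 z : seq (R * R),
     (size z <= K * D ^ l)%N &
     E `&` eucl_ball x (4 ^- n) `<=`
       \bigcup_(w in [set` z]) eucl_ball w (4 ^- (n + l))) ->
  (exists2 p, E p & forall n l, exists t : seq R,
    [/\ size t = (D ^ l)%N, uniq t,
        forall u, u \in t -> E (u, p.2) /\ `|p.1 - u| < 4 ^- n &
        {in t &, forall u v, u != v -> 4 ^- (n + l) <= `|u - v|}]) ->
  hbar E delta = s%:E.
Proof.
move=> s0 sD delta0 up [p Ep low]; apply/eqP; rewrite eq_le; apply/andP; split.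
  apply: ereal_inf_lbound; exists s => //; split=> //.
  exists 4^-1, ((K%:R + 1) * 16 `^ s); split; rewrite ?invr_gt0//.
  move=> r rho r0 rrho1 rrho2 rho4.
  have rrho := le_trans rrho1 rrho2.
  have rho0 := lt_le_trans r0 rrho.
  have [n n0 /andP[nrho rhon]] := exists_quarter_scale _ _ rho0 rho4.
  have [l lr l16] := exists_quarter_scale_between _ _ _ _ r0 rrho nrho.
  apply: ge_ereal_sup => _ [x Ex <-].
  have [z zK zE] := up x n l Ex n0.
  apply: (@le_trans _ _ ((size z)%:R%:E)).
    apply: covering_number_le => y [Ey yx].
    have [|w wz wy] := zE y; first by split=> //; exact: lt_le_trans yx rhon.
    by exists w => //; exact: lt_le_trans wy lr.
  rewrite lee_fin; apply: (@le_trans _ _ ((K * D ^ l)%N%:R)).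
    by rewrite ler_nat.
  rewrite natrM natrX -sD -powR_expn_swap -mulrA -powRM ?divr_ge0 ?(ltW r0) ?(ltW rho0)//.
  apply: ler_pM; rewrite ?powR_ge0// ?lerDl//.
  by apply: ge0_ler_powR => //; rewrite nnegrE ?exprn_ge0// mulr_ge0// divr_ge0// ltW.
apply: le_ereal_inf_tmp => _ [alpha [alpha0 [b [c [b0 c0 H]]]] <-].
rewrite lee_fin.
(* The large radius is fixed at [4 ^- n], below both [b] and 1. Only [l] grows, and [l >= l0]
   ensures the gap required by [delta]. *)
have m0 : 0 < Num.min b 1 by rewrite lt_min b0/=.
have [n] := exists_quarter_expn_lt _ _ m0; rewrite lt_min => /andP[nb n1].
have rho0 : 0 < 4 ^- n :> R by rewrite invr_gt0 exprn_gt0.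
have rho10 : 0 < (4 ^- n) `^ (1 + delta) :> R by rewrite powR_gt0.
have [l0 l0P] := exists_quarter_expn_lt _ _ rho10.
apply: (@ge_powR_exponent _ _ _ c l0) => // l l0l.
rewrite powR_expn_swap sD.
(* Half the separation, so that [2 * r] is exactly [4 ^- (n + l)]; this is the source of the ratio
   [2 * 4 ^+ l]. *)
pose r : R := 4 ^- (n + l) / 2.
have h0 : 0 < 4 ^- (n + l) :> R by rewrite invr_gt0 exprn_gt0.
have r0 : 0 < r by rewrite divr_gt0.
have rr : r <= (4 ^- n) `^ (1 + delta).
  have : 4 ^- (n + l) <= 4 ^- l0 :> R.
    rewrite lef_pV2 ?posrE ?exprn_gt0// ler_eXn2l ?ltr1n//.
    by rewrite (leq_trans l0l)// leq_addl.
  by rewrite /r; lra.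
have rho1 : (4 ^- n) `^ (1 + delta) <= 4 ^- n :> R.
  by apply: ge1r_powR; rewrite ?rho0/= ?ltW// ltrDl.
have := H r (4 ^- n) r0 rr rho1 (ltW nb).
have -> : 4 ^- n / r = 2 * 4 ^+ l.
  rewrite /r exprD; field.
  by rewrite !expf_neq0// pnatr_eq0.
rewrite -lee_fin; apply: le_trans.
have [t [tD tU tE tsep]] := low n l.
apply: (@le_trans _ _ (covering_number r (E `&` eucl_ball p (4 ^- n)))); last first.
  by apply: ereal_sup_ubound; exists p.
rewrite -natrX -tD.
apply: (@covering_number_separated _ r (4 ^- (n + l)) p.2) => //.
  by rewrite /r; lra.
move=> u /tE[Eu pu]; split=> //.
by rewrite /eucl_ball/= (surjective_pairing p) eucl_dist_horizontal.
Qed.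

(** The limit runs over positive [delta], where [hbar E] is constantly [s]. *)
Lemma dim_qA_homogeneous (R : realType) (E : set (R * R)) (D K : nat) (s : R) :
  0 <= s -> 4 `^ s = D%:R ->
  (forall x n l, E x -> (0 < n)%N -> exists2 z : seq (R * R),
     (size z <= K * D ^ l)%N &
     E `&` eucl_ball x (4 ^- n) `<=`
       \bigcup_(w in [set` z]) eucl_ball w (4 ^- (n + l))) ->
  (exists2 p, E p & forall n l, exists t : seq R,
    [/\ size t = (D ^ l)%N, uniq t,
        forall u, u \in t -> E (u, p.2) /\ `|p.1 - u| < 4 ^- n &
        {in t &, forall u v, u != v -> 4 ^- (n + l) <= `|u - v|}]) ->
  dim_qA E = s%:E.
Proof.
move=> s0 sD up low; apply: lim_near_cst; first exact: ereal_hausdorff.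
near=> delta.
by apply: hbar_homogeneous up low => //; near: delta; exact: nbhs_right_gt.
Unshelve. all: by end_near. Qed.

(** * The Cantor set of dimension 1/2 *)

(* Digits 0 and 2 in base 4, rather than 0 and 1, keep the two pieces at
   distance more than 1/4; [cantor] is the countable set of left endpoints, which
   has the same covering numbers as its closure up to a constant factor. *)
Fixpoint cantor_approx (R : realType) (n : nat) : seq R :=
  if n is m.+1 then
    [seq (2 * b%:R + x) / 4 | b : bool <- [:: false; true],
                              x : R <- cantor_approx R m]
  else [:: 0].

Definition cantor (R : realType) : set R := [set x | exists n, x \in cantor_approx R n].
Arguments cantor {R}.

Lemma bool_natr_le1 (R : realType) (b : bool) : 0 <= (b%:R : R) <= 1.
Proof. by case: b; rewrite ?lexx ler01. Qed.

Lemma mem_cantor_approxS (R : realType) n (x : R) :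
  reflect (exists (b : bool) (t : R),
             t \in cantor_approx R n /\ x = (2 * b%:R + t) / 4)
          (x \in cantor_approx R n.+1).
Proof.
apply: (iffP allpairsP) => [[[b t] /= [_ tn ->]]|[b [t [tn ->]]]].
  by exists b, t.
by exists (b, t); split=> //; case: b.
Qed.

Lemma cantor_approx_itv (R : realType) n (x : R) :
  x \in cantor_approx R n -> 0 <= x < 1.
Proof.
elim: n x => [x|n IH x /mem_cantor_approxS[b [t [/IH]]]].
  by rewrite inE => /eqP->; rewrite lexx ltr01.
move=> /andP[t0 t1] ->; have /andP[b0 b1] := bool_natr_le1 R b.
by apply/andP; split; lra.
Qed.

Lemma size_cantor_approx (R : realType) n : size (cantor_approx R n) = (2 ^ n)%N.
Proof. by elim: n => //= n IH; rewrite size_cat cats0 !size_map IH expnS mul2n addnn. Qed.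

(** The two pieces lie in [[0, 1/4)] and [[1/2, 3/4)]. *)
Lemma cantor_digit_gap (R : realType) (b c : bool) (t u : R) :
  0 <= t < 1 -> 0 <= u < 1 -> b != c ->
  4^-1 < `|(2 * b%:R + t) / 4 - (2 * c%:R + u) / 4|.
Proof.
move=> /andP[t0 t1] /andP[u0 u1].
by case: b c => -[]// _; rewrite ltr_normr /=; apply/orP;
  [left|right]; lra.
Qed.

(** Induction on the leading digit: equal digits reduce to the tails scaled by 1/4, and distinct
    digits already give a distance above 1/4. *)
Lemma cantor_approx_separated (R : realType) n :
  {in cantor_approx R n &, forall x y : R, x != y -> 4 ^- n <= `|x - y|}.
Proof.
elim: n => [|n IH] x y.
  by rewrite !inE => /eqP-> /eqP->; rewrite eqxx.
move=> /mem_cantor_approxS[b [t [tn ->]]] /mem_cantor_approxS[c [u [un ->]]] xy.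
have [bc|bc] := eqVneq b c.
  have tu : t != u by apply: contraNneq xy => ->; rewrite bc.
  have -> : (2 * b%:R + t) / 4 - (2 * c%:R + u) / 4 =
            (t - u) / 4 :> R by rewrite bc; field.
  by rewrite normrM [`|4^-1|]gtr0_norm ?invr_gt0// exprSr invfM ler_pM2r ?invr_gt0 ?IH.
apply: le_trans (ltW (cantor_digit_gap _ _ _ _ _ _ _ bc)).
- by rewrite exprS invfM ler_piMr ?invr_ge0// invf_le1 ?exprn_gt0// exprn_ege1// ler1n.
- exact: cantor_approx_itv tn.
- exact: cantor_approx_itv un.
Qed.

Lemma uniq_cantor_approx (R : realType) n : uniq (cantor_approx R n).
Proof.
elim: n => // n IH; apply: allpairs_uniq => //.
move=> [b t] [c u] /allpairsP[[b1 t1] [_ /cantor_approx_itv ti [-> ->]]].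
move=> /allpairsP[[c1 u1] [_ /cantor_approx_itv ui [-> ->]]] E.
rewrite /= in ti ui E *.
have [bc|bc] := eqVneq b1 c1; first by rewrite bc in E *; congr pair; lra.
have := cantor_digit_gap _ _ _ _ _ ti ui bc.
by rewrite E subrr normr0 ltNge invr_ge0 ler0n.
Qed.

Lemma cantor0 (R : realType) : cantor (0 : R).
Proof. by exists 0%N; rewrite inE. Qed.

Lemma cantor_itv (R : realType) (x : R) : cantor x -> 0 <= x < 1.
Proof. by case=> n; exact: cantor_approx_itv. Qed.

(** Prefixing [n] zero digits divides by [4 ^+ n]. This puts a small copy of the set near 0, where
    the lower bound is tested. *)
Lemma cantor_div_expn (R : realType) n (x : R) : cantor x -> cantor (x / 4 ^+ n).
Proof.
elim: n x => [|n IH] x Cx; first by rewrite expr0 divr1.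
have [k xk] := IH x Cx; exists k.+1; apply/mem_cantor_approxS.
exists false, (x / 4 ^+ n); split=> //.
by rewrite mulr0 add0r exprSr invfM mulrA.
Qed.

Lemma cantor_first_digit (R : realType) (x : R) :
  cantor x -> exists (b : bool) (t : R), cantor t /\ x = (2 * b%:R + t) / 4.
Proof.
move=> [[|n]].
  rewrite inE => /eqP->; exists false, 0.
  by split; [exact: cantor0|rewrite mulr0 addr0 mul0r].
by move=> /mem_cantor_approxS[b [t [tn ->]]]; exists b, t; split=> //; exists n.
Qed.

(** Here [t] is the truncation of the base 4 expansion of [x] to [n] digits. *)
Lemma cantor_approximation (R : realType) n (x : R) :
  cantor x -> exists2 t, t \in cantor_approx R n & t <= x < t + 4 ^- n.
Proof.
elim: n x => [|n IH] x.
  move=> /cantor_itv x01; exists 0; rewrite ?inE//.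
  by rewrite expr0 invr1 add0r.
move=> /cantor_first_digit[b [y [/IH[t tn /andP[ty yt]] ->]]].
exists ((2 * b%:R + t) / 4); first by apply/mem_cantor_approxS; exists b, t.
by rewrite exprS invfM; apply/andP; split; lra.
Qed.

(** The integer [m] is read off the first [n] digits and [t] is the remaining tail. Integrality of
    [m] is what limits the number of pieces near a given point. *)
Lemma cantor_self_similar (R : realType) n (x : R) :
  cantor x -> exists (m : int) (t : R), cantor t /\ x = (m%:~R + t) / 4 ^+ n.
Proof.
elim: n x => [|n IH] x Cx.
  by exists 0, x; split=> //; rewrite add0r expr0 divr1.
have [m [_ [/cantor_first_digit[b [t [Ct ->]]] ->]]] := IH x Cx.
(* The next digit [2 * b] is appended to [m] in base 4. *)
exists (4 * m + 2 * b%:Z), t; split=> //.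
rewrite exprS intrD !intrM -pmulrn.
by field; rewrite expf_neq0// pnatr_eq0.
Qed.

(** * The stacked copies have dimension 1/2 *)

Definition stacked_cantor (R : realType) : set (R * R) :=
  [set p | exists (q : rat) (x : R), cantor x /\ p = (ratr q + x, (pickle q)%:R)].

(** Heights are natural numbers and the ball is open of radius at most 1, so both points have the
    same height; [pickle] is injective. *)
Lemma stacked_cantor_layer (R : realType) (q q' : rat) (x x' : R) (n : nat) :
  eucl_ball (ratr q + x, (pickle q)%:R) (4 ^- n) (ratr q' + x', (pickle q')%:R) ->
  q = q' /\ `|x - x'| < 4 ^- n.
Proof.
move=> H; suff qq : q = q'.
  split=> //; move: H; rewrite /eucl_ball /= qq eucl_dist_horizontal.
  by rewrite opprD addrACA subrr add0r.
apply: (pcan_inj pickleK).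
have := norm_snd_eucl_dist _ (ratr q + x, (pickle q)%:R : R)
  (ratr q' + x', (pickle q')%:R).
move=> /le_lt_trans/(_ H) /= /lt_le_trans-/(_ 1).
rewrite invf_le1 ?exprn_gt0// exprn_ege1 ?ler1n// => /(_ isT).
rewrite ltr_distl ltrBlDr !natr1 !ltr_nat !ltnS => /andP[h1 h2].
by apply/eqP; rewrite eqn_leq h1 h2.
Qed.

Lemma stacked_cantor_cover (R : realType) (p : R * R) (n l : nat) :
  stacked_cantor R p -> exists2 z : seq (R * R),
     (size z <= 3 * 2 ^ l)%N &
     stacked_cantor R `&` eucl_ball p (4 ^- n) `<=`
       \bigcup_(w in [set` z]) eucl_ball w (4 ^- (n + l)).
Proof.
have P4 k : 0 < 4 ^+ k :> R by rewrite exprn_gt0.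
move=> [q [x [Cx ->]]].
have [m [t [Ct xE]]] := cantor_self_similar _ n _ Cx.
(* Centres on the layer of [p]: the leading integer is [m - 1], [m] or [m + 1], followed by one of
   [2 ^ l] truncated tails. *)
exists [seq (ratr q + ((m + j)%:~R + u) / 4 ^+ n, (pickle q)%:R : R)
         | j <- [:: -1; 0; 1], u <- cantor_approx R l].
  by rewrite size_allpairs size_cantor_approx.
move=> _ [[q' [x' [Cx' ->]]]] /stacked_cantor_layer[<- xx'].
have [m' [t' [Ct' xE']]] := cantor_self_similar _ n _ Cx'.
have [u ul /andP[ut tu]] := cantor_approximation _ l _ Ct'.
exists (ratr q + (m'%:~R + u) / 4 ^+ n, (pickle q)%:R); last first.
  rewrite /eucl_ball /= eucl_dist_horizontal xE'.
  have -> : ratr q + (m'%:~R + u) / 4 ^+ n - (ratr q + (m'%:~R + t') / 4 ^+ n) =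
            - ((t' - u) / 4 ^+ n) by field; rewrite gt_eqF.
  rewrite normrN ger0_norm ?divr_ge0 ?subr_ge0 ?(ltW (P4 _))//.
  by rewrite exprD invfM mulrC ltr_pM2l ?invr_gt0//; lra.
apply/allpairsP; exists (m' - m, u); split=> //=; last by rewrite subrKC.
have /andP[t0 t1] := cantor_itv _ _ Ct; have /andP[t0' t1'] := cantor_itv _ _ Ct'.
(* After scaling by [4 ^+ n] the points are less than 1 apart. As [t] and [t'] lie in [[0, 1)], the
   integers differ by less than 2, hence by at most 1. *)
have : `|(m%:~R + t) - (m'%:~R + t')| < 1.
  move: xx'; rewrite xE xE' -mulrBl normrM [`|_^-1|]gtr0_norm ?invr_gt0//.
  by rewrite -[ltRHS]mul1r ltr_pM2r ?invr_gt0.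
rewrite ltr_norml => /andP[h1 h2].
have : (m' - m)%:~R < 2%:~R :> R by rewrite intrB; lra.
have : (-2)%:~R < (m' - m)%:~R :> R by rewrite intrB; lra.
rewrite !ltr_int !inE => h3 h4.
by lia.
Qed.

Lemma dim_qA_stacked_cantor (R : realType) :
  dim_qA (stacked_cantor R) = (2^-1)%:E.
Proof.
apply: (@dim_qA_homogeneous _ _ 2 3).
- by rewrite invr_ge0.
- by rewrite powR12_sqrt// (_ : 4 = 2 ^+ 2) ?sqrtr_sqr ?ger0_norm// -natrX.
- by move=> p n l Ep _; exact: stacked_cantor_cover.
have Q0 : stacked_cantor R (0, (pickle (0 : rat))%:R).
  by exists 0, 0; split; [exact: cantor0|rewrite rmorph0 addr0].
exists (0, (pickle (0 : rat))%:R) => // n l.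
have P4 : 0 < 4 ^+ n :> R by rewrite exprn_gt0.
(* The level [l] endpoints, shrunk by [4 ^+ n] towards 0 in the copy attached to the rational 0. *)
exists [seq x / 4 ^+ n | x <- cantor_approx R l]; split.
- by rewrite size_map size_cantor_approx.
- rewrite map_inj_uniq; first exact: uniq_cantor_approx.
  by apply: mulIf; rewrite invr_eq0 gt_eqF.
- move=> _ /mapP[x xl ->]; have /andP[x0 x1] := cantor_approx_itv _ _ _ xl.
  split; last first.
    by rewrite /= sub0r normrN ger0_norm ?divr_ge0 ?(ltW P4)// gtr_pMl ?invr_gt0.
  exists 0, (x / 4 ^+ n); split; last by rewrite rmorph0 add0r.
  by apply: cantor_div_expn; exists l.
- move=> _ _ /mapP[x xl ->] /mapP[y yl ->] xy.
  rewrite -mulrBl normrM [`|_^-1|]gtr0_norm ?invr_gt0// exprD invfM mulrC.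
  rewrite ler_pM2r ?invr_gt0//; apply: cantor_approx_separated => //.
  by apply: contraNneq xy => ->.
Qed.

(** * The projection has dimension 1 *)

Lemma dim_qA_proj_stacked_cantor (R : realType) :
  dim_qA (@proj_x R @` stacked_cantor R) = 1%:E.
Proof.
apply: (@dim_qA_homogeneous _ _ 4 2).
- by [].
- by rewrite powRr1.
- move=> p n l _ _.
  pose h : R := 4 ^- (n + l).
  have h0 : 0 < h by rewrite invr_gt0 exprn_gt0.
  have hE : 4 ^- n = 4 ^+ l * h.
    by rewrite /h exprD; field; rewrite !expf_neq0// pnatr_eq0.
  (* A grid of step [h] across the interval of half-length [4 ^+ l * h] around [p.1]; this covers
     any subset of the axis. *)
  exists [seq (p.1 + (i%:R - 4 ^+ l) * h, 0 : R) | i <- iota 0 (2 * 4 ^ l)].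
    by rewrite size_map size_iota.
  move=> _ [[[y y2] _ <-]]; rewrite /proj_x /=.
  move=> /(le_lt_trans (norm_fst_eucl_dist _ _ _)) /=.
  rewrite hE ltr_distl => /andP[yl yr].
  (* Position of [y] in units of [h] from the left end of the interval; its integer part selects the
     centre, at distance less than [h]. *)
  pose w := (y - p.1) / h + 4 ^+ l.
  have w0 : 0 <= w by rewrite -lerBlDr sub0r ler_pdivlMr//; lra.
  have wl : w < 2 * 4 ^+ l.
    have : (y - p.1) / h < 4 ^+ l by rewrite ltr_pdivrMr//; lra.
    by rewrite /w; lra.
  have yE : y = p.1 + (w - 4 ^+ l) * h.
    by rewrite /w addrK divfK ?gt_eqF// addrC subrK.
  have /andP[iw wi] := truncn_itv w0.
  exists (p.1 + ((Num.truncn w)%:R - 4 ^+ l) * h, 0).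
    apply/mapP; exists (Num.truncn w) => //; rewrite mem_iota add0n /=.
    by rewrite -(ltr_nat R) natrM natrX; exact: le_lt_trans wl.
  rewrite /eucl_ball /= eucl_dist_horizontal yE -/h.
  rewrite opprD addrACA subrr add0r -mulrBl normrM (gtr0_norm h0).
  rewrite gtr_pMl// distrC opprB addrA subrK ger0_norm ?subr_ge0//.
  by rewrite ltrBlDr nat1r.
(* As 0 lies in the Cantor set, the copy translated by [q] projects onto a set containing [q]. *)
have projE q : (proj_x (R:=R) @` stacked_cantor R) (ratr q, 0).
  exists (ratr q, (pickle q)%:R) => //.
  by exists q, 0; split; [exact: cantor0|rewrite addr0].
exists (0, 0); first by have := projE 0; rewrite rmorph0.
move=> n l; pose h : R := 4 ^- (n + l).
have h0 : 0 < h by rewrite invr_gt0 exprn_gt0.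
(* These grid points are rational, so they all belong to the projection, though they come from
   different layers. *)
exists [seq i%:R * h | i <- iota 0 (4 ^ l)]; split.
- by rewrite size_map size_iota.
- rewrite map_inj_uniq ?iota_uniq// => i j /(mulIf (lt0r_neq0 h0)).
  by move/eqP; rewrite eqr_nat => /eqP.
- move=> _ /mapP[i + ->]; rewrite mem_iota add0n /= => il; split.
    have -> : i%:R * h = ratr (i%:R / 4 ^+ (n + l)).
      by rewrite fmorph_div rmorphXn /= !ratr_nat.
    exact: projE.
  rewrite sub0r normrN ger0_norm ?mulr_ge0 ?(ltW h0)//.
  rewrite /h exprD invfM mulrCA gtr_pMr ?invr_gt0 ?exprn_gt0//.
  by rewrite ltr_pdivrMr ?exprn_gt0// mul1r -natrX ltr_nat.
- move=> _ _ /mapP[i _ ->] /mapP[j _ ->] ij.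
  rewrite -mulrBl normrM (gtr0_norm h0) ler_peMl ?(ltW h0)//.
  have {ij} : i != j by apply: contraNneq ij => ->.
  have [ltij|ltji|//] := ltngtP i j => _; [rewrite distrC|].
    by rewrite -natrB ?(ltnW ltij)// normr_nat ler1n subn_gt0.
  by rewrite -natrB ?(ltnW ltji)// normr_nat ler1n subn_gt0.
Qed.

Theorem proposition12 (R : realType) :
  exists E : set (R * R),
    [/\ dim_qA (@proj_x R @` E) = 1%:E,
        (2^-1%:E < 1%:E :> \bar R)%E &
        dim_qA E = 2^-1%:E].
Proof.
exists (stacked_cantor R); split.
- exact: dim_qA_proj_stacked_cantor.
- by rewrite lte_fin invf_lt1// ltr1n.
- exact: dim_qA_stacked_cantor.
Qed.
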